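(* Let $\mathcal{F}$ be the collection of all finite subsets of $\mathbb{N}$. Let $f:\mathcal{F}\to\mathbb{C}$ be a function that is not identically zero and let $g:\mathcal{F}\to\mathbb{C}$ be given by $$g(y)=\sum_{x\subseteq y} f(x)\qquad (y\in\mathcal{F}),$$ so that $$f(y)=\sum_{x\subseteq y}(-1)^{|y|-|x|}g(x)\qquad (y\in\mathcal{F}).$$ Then the support of $f$ and the support of $g$ cannot both be finite.
   Context: The support of a function $h:\mathcal{F}\to\mathbb{C}$ is the set $\{x\in\mathcal{F}: h(x)\neq 0\}$. The sums range over all subsets $x$ of the finite set $y$, and $|x|$ denotes the cardinality of $x$. *)

(* Defs.v *)
From HB Require Import structures.
From mathcomp Require Import all_boot all_order all_algebra.
From mathcomp Require Import finmap complex.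
From mathcomp Require Import boolp classical_sets cardinality reals.

Set Implicit Arguments.
Unset Strict Implicit.
Unset Printing Implicit Defensive.

Import GRing.Theory.

Local Open Scope ring_scope.
Local Open Scope classical_set_scope.

Definition fsupport (R : realType) (h : {fset nat} -> R[i]) : set {fset nat} :=
  [set x | h x != 0].

(* Main.v *)
Require Import Defs.
From HB Require Import structures.
From mathcomp Require Import all_boot all_order all_algebra.
From mathcomp Require Import finmap complex.
From mathcomp Require Import boolp classical_sets cardinality reals.

Set Implicit Arguments.
Unset Strict Implicit.
Unset Printing Implicit Defensive.

Import GRing.Theory.

Local Open Scope ring_scope.
Local Open Scope fset_scope.

(* If supp f and supp g are finite, some n lies outside y and outside every
   set in either support.  Then 0 = g (y + n) = g y, because the subsets of
   y + n that contain n contribute nothing.  Hence g = 0, and f = 0 by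
   Moebius inversion. *)

Lemma big_fpowersetU1 (K : choiceType) (V : nmodType) (a : K) (y : {fset K})
    (F : {fset K} -> V) : a \notin y ->
  \sum_(x <- fpowerset (a |` y)) F x =
  \sum_(x <- fpowerset y) (F x + F (a |` x)).
Proof.
move=> ay; rewrite big_split -(big_map (fun x => a |` x) xpredT) -big_cat.
have aNsub x : x \in fpowerset y -> a \notin x.
  by rewrite fpowersetE => /fsubsetP xy; apply: contra ay => /xy.
apply/perm_big/uniq_perm; first exact: fset_uniq.
  rewrite cat_uniq fset_uniq map_inj_in_uniq ?fset_uniq ?andbT /=.
    apply/hasPn => _ /mapP[x _ ->]; apply/negP => /aNsub.
    by rewrite fset1U1.
  by move=> x z /aNsub ax /aNsub az xz; rewrite -(fsetU1K ax) xz fsetU1K.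
move=> x; rewrite mem_cat !fpowersetE.
apply/idP/orP => [xay|[xy|/mapP[z]]]; last 2 first.
- exact: fsubset_trans xy (fsubsetU1 _ _).
- by rewrite fpowersetE => zy ->; apply: fsetUS.
(* This set settles both cases: it is the preimage of [x] under insertion of [a] when [a] is in [x],
   and is [x] itself otherwise. *)
have xDy : x `\ a `<=` y by rewrite fsubDset.
have [ax|ax] := boolP (a \in x); [right|left].
  by apply/mapP; exists (x `\ a); rewrite ?fpowersetE// fsetD1K.
by rewrite -(mem_fsetD1 ax).
Qed.

(** Induction on [y] with [f] varying: after adding [a], the terms of [x] and [a |] x[have opposite
    signs, and their sum is the term of]x[for the function]z => f (a |[z)]. *)
Lemma fset_moebius_inversion (K : choiceType) (A : pzRingType)
    (f : {fset K} -> A) (y : {fset K}) :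
  f y = \sum_(x <- fpowerset y)
          (-1) ^+ (#|` y| - #|` x|)%N * \sum_(z <- fpowerset x) f z.
Proof.
elim/fset1U_rect: y f => [|a y ay IH] f.
  by rewrite fpowerset0 !big_seq_fset1 fpowerset0 big_seq_fset1 mul1r.
rewrite big_fpowersetU1// [LHS](IH (fun z => f (a |` z))).
rewrite [LHS]big_seq [RHS]big_seq; apply: eq_bigr => x.
rewrite fpowersetE => xy.
have ax : a \notin x by apply: contra ay => /(fsubsetP xy).
(* The subtraction is truncated, so extracting the extra sign from the term of [x] needs [x] to be
   no larger than [y]. *)
rewrite !cardfsU1 ay ax /= !add1n subSS subSn ?fsubset_leq_card//.
by rewrite big_fpowersetU1// big_split mulrDr exprS !mulN1r mulNr addKr.
Qed.

Lemma fset_nat_fresh (s : {fset nat}) : exists n, n \notin s.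
Proof.
exists (\max_(i <- s) i).+1; apply/negP => ns.
by have := @leq_bigmax_seq _ (enum_fset s) xpredT id _ ns isT; rewrite ltnn.
Qed.

(** Reduces avoiding every member of a support to avoiding a single finite set, the union of the
    members. *)
Lemma finite_family_bounded (K : choiceType) (S : set {fset K}) :
  finite_set S -> exists B : {fset K}, forall x, S x -> x `<=` B.
Proof.
move=> /finite_seqP[s ->]; exists (\bigcup_(x <- s) x) => x /= xs.
exact: bigfcup_sup.
Qed.

Theorem proposition3p2 (R : realType) (f g : {fset nat} -> R[i])
    (f_neq0 : ~ (forall x, f x = 0))
    (gE : forall y, g y = \sum_(x <- fpowerset y) f x) :
  (forall y, f y = \sum_(x <- fpowerset y)
                     (-1) ^+ (#|` y| - #|` x|)%N * g x) /\
  ~ (finite_set (fsupport f) /\ finite_set (fsupport g)).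
Proof.
have fE y : f y = \sum_(x <- fpowerset y) (-1) ^+ (#|` y| - #|` x|)%N * g x.
  by rewrite [LHS]fset_moebius_inversion; apply: eq_bigr => x _; rewrite gE.
split=> // -[/finite_family_bounded[A fA] /finite_family_bounded[B gB]].
suff g0 y : g y = 0.
  by apply: f_neq0 => y; rewrite fE big1// => x _; rewrite g0 mulr0.
have [n] := fset_nat_fresh (y `|` (A `|` B)).
rewrite !inE !negb_or => /and3P[ny nA nB].
have h0 h C x : (forall z, fsupport h z -> z `<=` C) -> n \notin C ->
    h (n |` x) = 0 :> R[i].
  move=> hC nC; apply: contraNeq nC => /hC/fsubsetP; apply.
  exact: fset1U1.
have := gE (n |` y); rewrite (h0 _ _ _ gB nB) big_fpowersetU1//.
under eq_bigr do rewrite (h0 _ _ _ fA nA) addr0.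
by rewrite -gE.
Qed.
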